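(* Let $n\ge 2$ be an integer. Then $\overline{M}_n$ is a strongly $E^*$-unitary inverse semigroup.
   Context: For an integer $n\ge 2$, $\overline{M}_n$ is the set consisting of an element $\mathbf{0}$ together with all triplets $\prec k,d,m\succ$ of real numbers $k,d,m$ satisfying $1-\min(0,d)\le k\le m\le n-\max(0,d)$. Multiplication on $\overline{M}_n$: $\mathbf{0}x=x\mathbf{0}=\mathbf{0}$ for all $x$, and for nonzero elements, $\prec k,d,m\succ\prec k',d',m'\succ$ equals $\prec k'',d'',m''\succ$ if $k''\le m''$ and equals $\mathbf{0}$ if $k''>m''$, where $k''=\max(k,k'-d)$, $d''=d+d'$, $m''=\min(m,m'-d)$. This is an inverse monoid with zero $\mathbf{0}$ and identity $\prec 1,0,n\succ$. For a group $G$, $G^0=G\cup\{0\}$ denotes the group with a zero adjoined. An inverse semigroup $S$ with zero is strongly $E^*$-unitary if there exist a group $G$ and an idempotent-pure $0$-morphism $\varphi:S\to G^0$, that is, a map such that: $\varphi(x)=0$ if and only if $x$ is the zero of $S$ ($0$-restricted); $\varphi(xy)=\varphi(x)\varphi(y)$ for all $x,y\in S$ with $xy$ not equal to the zero of $S$; and $\varphi(x)=1_G$ implies that $x$ is idempotent (idempotent-pure). *)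

(* Defs.v *)
From HB Require Import structures.
From mathcomp Require Import all_boot all_order all_algebra.
From mathcomp Require Import reals.

Set Implicit Arguments.
Unset Strict Implicit.
Unset Printing Implicit Defensive.

Import Order.TTheory GRing.Theory Num.Theory.

Section Semigroups.
Local Open Scope group_scope.

Definition inverse_semigroup (S : semigroupType) : Prop :=
  forall x : S, exists! y : S, x * y * x = x /\ y * x * y = y.

Definition is_zero (S : semigroupType) (z : S) : Prop :=
  forall x : S, z * x = z /\ x * z = z.

(* The group with zero G^0: [Some g] is the element g of G, [None] is the
   adjoined zero. *)
Definition group0 (G : groupType) : Type := option G.

Definition group0_mul (G : groupType) (a b : group0 G) : group0 G :=
  if a is Some g then if b is Some h then Some (g * h) else None else None.

Lemma group0_mulA (G : groupType) : associative (@group0_mul G).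
Proof. by move=> [a|] [b|] [c|] //=; rewrite mulgA. Qed.

HB.instance Definition _ (G : groupType) := Choice.on (group0 G).
HB.instance Definition _ (G : groupType) :=
  isSemigroup.Build (group0 G) (@group0_mulA G).

Definition idempotent_pure_0morphism (S : semigroupType) (z : S)
    (G : groupType) (phi : S -> group0 G) : Prop :=
  [/\ forall x : S, phi x = None <-> x = z,
      forall x y : S, x * y <> z -> phi (x * y) = phi x * phi y
    & forall x : S, phi x = Some 1 -> x * x = x].

Definition strongly_Estar_unitary (S : semigroupType) : Prop :=
  inverse_semigroup S /\
  exists z : S, is_zero z /\
    exists (G : groupType) (phi : S -> group0 G),
      idempotent_pure_0morphism z phi.

End Semigroups.

Section Mbar.
Local Open Scope ring_scope.
Variables (R : realType) (n : nat).

Definition triplet_cond (t : R * R * R) : bool :=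
  let: (k, d, m) := t in
  [&& 1 - Num.min 0 d <= k, k <= m & m <= n%:R - Num.max 0 d].

Record triplet : Type := Triplet {
  triplet_val : R * R * R;
  _ : triplet_cond triplet_val
}.

HB.instance Definition _ := [isSub for triplet_val].
HB.instance Definition _ := [Choice of triplet by <:].

(* [None] is the element 0. *)
Definition Mbar : Type := option triplet.

HB.instance Definition _ := Choice.on Mbar.

Definition raw_mul (t t' : R * R * R) : R * R * R :=
  let: (k, d, m) := t in
  let: (k', d', m') := t' in
  (Num.max k (k' - d), d + d', Num.min m (m' - d)).

(* The test k'' <= m'' deciding whether a product is nonzero. *)
Definition raw_le (t : R * R * R) : bool := let: (k, _, m) := t in k <= m.

Lemma triplet_condE k d m : triplet_cond (k, d, m) =
  [&& 1 <= k, 1 - d <= k, k <= m, m <= n%:R & m <= n%:R - d].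
Proof.
rewrite /triplet_cond lerBlDr -lerBlDl le_min lerBrDr -lerBrDl ge_max.
have -> : (d <= n%:R - m) = (m <= n%:R - d) by rewrite !lerBrDr addrC.
by rewrite subr_le0 subr_ge0 lerBlDl -lerBlDr -andbA.
Qed.

Lemma triplet_cond_mul (a b : triplet) :
  raw_le (raw_mul (val a) (val b)) -> triplet_cond (raw_mul (val a) (val b)).
Proof.
move: (valP a) (valP b); case: (val a) (val b) => [[k d] m] [[k' d'] m'].
rewrite [raw_mul _ _]/= !triplet_condE => + + hle.
case/and5P=> h1 h2 _ h4 h5 /and5P[g1 g2 _ g4 g5].
rewrite [_ <= Num.min _ _]hle !le_max !ge_min h1 h4 /= opprD !addrA.
by rewrite (addrAC 1) (addrAC n%:R) !lerD2r g2 g5 !orbT.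
Qed.

(* Nonzero exactly when k'' <= m''; [triplet_cond_mul] shows that the product
   triplet then satisfies the defining inequalities. *)
Definition Mbar_mul (x y : Mbar) : Mbar :=
  match x, y with
  | Some a, Some b =>
      if @idP (raw_le (raw_mul (val a) (val b))) is ReflectT h
      then Some (Triplet (triplet_cond_mul h)) else None
  | _, _ => None
  end.

Definition raw (x : Mbar) : option (R * R * R) := omap val x.

Lemma raw_inj : injective raw.
Proof. exact/inj_omap/val_inj. Qed.

Definition oraw_mul (u v : option (R * R * R)) : option (R * R * R) :=
  match u, v with
  | Some s, Some t => if raw_le (raw_mul s t) then Some (raw_mul s t) else None
  | _, _ => None
  end.

Lemma raw_Mbar_mul (x y : Mbar) :
  raw (Mbar_mul x y) = oraw_mul (raw x) (raw y).
Proof.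
case: x y => [a|] [b|] //=.
by case: {-}_ / idP => [h|/negP/negbTE h] /=; rewrite h.
Qed.

Lemma oraw_mulA : associative oraw_mul.
Proof.
have mulA s t u : raw_mul s (raw_mul t u) = raw_mul (raw_mul s t) u.
  case: s t u => [[k d] m] [[k' d'] m'] [[k'' d''] m''] /=.
  rewrite !addr_maxl !addr_minl !maxA !minA opprD !addrA.
  by rewrite (addrAC k'') (addrAC m'').
have leL s t u : raw_le (raw_mul s (raw_mul t u)) -> raw_le (raw_mul t u).
  case: s t u => [[k d] m] [[k' d'] m'] [[k'' d''] m''] /=.
  by rewrite ge_max !le_min => /and3P[_ _]; rewrite lerD2r le_min.
have leR s t u : raw_le (raw_mul (raw_mul s t) u) -> raw_le (raw_mul s t).
  case: s t u => [[k d] m] [[k' d'] m'] [[k'' d''] m''] /=.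
  by rewrite ge_max !le_min => /andP[/andP[]].
move=> [s|] [t|] [u|] //=; last by case: ifP.
case: (boolP (raw_le (raw_mul t u))) => h /=;
  case: (boolP (raw_le (raw_mul s t))) => g //=.
- by rewrite mulA.
- by rewrite mulA; case: ifP => // /leR; rewrite (negbTE g).
- by rewrite -mulA; case: ifP => // /leL; rewrite (negbTE h).
Qed.

Lemma Mbar_mulA : associative Mbar_mul.
Proof.
by move=> x y z; apply: raw_inj; rewrite !raw_Mbar_mul oraw_mulA.
Qed.

HB.instance Definition _ := isSemigroup.Build Mbar Mbar_mulA.

End Mbar.

(* Main.v *)
Require Import Defs.
From mathcomp Require Import all_boot all_order all_algebra.
From mathcomp Require Import reals.

(** A triplet (k, d, m) acts as the partial translation x |-> x + d with domain
    the interval [k, m]; the inequalities on triplets say that the domain and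
    the image [k + d, m + d] lie in [1, n].  The product is composition of
    partial maps (left factor first), with the empty map as zero.  The inverse
    of such a map is the translation by -d on the image [k + d, m + d]; this
    gives a generalized inverse [raw_inv].  It is the only one: if t is a
    generalized inverse of s, comparing the middle entries forces the shift -d,
    and then the domain of s is mapped into the domain of t and conversely, so
    that the domain of t is exactly the image of s.

    Shifts add up under composition, so reading off the shift is a 0-morphism
    to the additive group of the reals.  A partial translation by 0 is the
    identity of its domain, hence idempotent, which makes this morphism
    idempotent-pure. *)

Set Implicit Arguments.
Unset Strict Implicit.
Unset Printing Implicit Defensive.

Import Order.TTheory GRing.Theory Num.Theory.
Local Open Scope ring_scope.

Section MbarInverse.
Variables (R : realType) (n : nat).
Implicit Types (s t : R * R * R) (x y : Mbar R n).

Definition raw_inv t : R * R * R :=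
  let: (k, d, m) := t in (k + d, - d, m + d).

Lemma raw_invK : involutive raw_inv.
Proof. by case=> [[k d] m] /=; rewrite opprK !addrK. Qed.

(** The condition on triplets bounds the domain and the image of a partial
    translation by the same interval [1, n], and inversion swaps the two. *)
Lemma triplet_cond_inv t : triplet_cond n t -> triplet_cond n (raw_inv t).
Proof.
case: t => [[k d] m]; rewrite !triplet_condE => /and5P[h1 h2 h3 h4 h5].
by rewrite opprK !lerD2r h1 h3 -lerBlDr h2 -lerBrDr h5.
Qed.

Lemma triplet_cond_raw_le t : triplet_cond n t -> raw_le t.
Proof. by case: t => [[k d] m]; rewrite triplet_condE => /and5P[]. Qed.

Lemma raw_mul_inv t : raw_mul t (raw_inv t) = (t.1.1, 0, t.2).
Proof. by case: t => [[k d] m] /=; rewrite !addrK maxxx minxx subrr. Qed.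

Lemma raw_mulKV t : raw_mul (raw_mul t (raw_inv t)) t = t.
Proof.
by case: t => [[k d] m]; rewrite raw_mul_inv /= !subr0 maxxx minxx add0r.
Qed.

Lemma oraw_mulKV t : triplet_cond n t ->
  oraw_mul (oraw_mul (Some t) (Some (raw_inv t))) (Some t) = Some t.
Proof.
move=> /triplet_cond_raw_le le_t.
have le_tV : raw_le (raw_mul t (raw_inv t)).
  by rewrite raw_mul_inv; case: t le_t => [[k d] m].
by rewrite /= le_tV /= raw_mulKV le_t.
Qed.

(** The middle entries force opposite shifts.  Then s t s = s says that s
    carries its domain into that of t, and t s t = t that t carries its domain
    into that of s, so each endpoint of the domain of t is pinned from both
    sides. *)
Lemma raw_inv_unique s t :
  raw_mul (raw_mul s t) s = s -> raw_mul (raw_mul t s) t = t -> t = raw_inv s.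
Proof.
case: s t => [[k d] m] [[k' d'] m'] /= [hk hd hm] [hk' _ hm'].
have d'E : d' = - d.
  by apply/(addrI d)/(addIr d); rewrite hd subrr add0r.
move: hk hm hk' hm'; rewrite d'E opprK => hk hm hk' hm'.
congr (_, _, _); apply/le_anti/andP; split.
- by rewrite -lerBlDr -hk !le_max lexx orbT.
- by rewrite -hk' !le_max lexx orbT.
- by rewrite -hm' !ge_min lexx orbT.
- by rewrite -lerBrDr -hm !ge_min lexx orbT.
Qed.

Lemma oraw_mul_Some s t u :
  oraw_mul (oraw_mul (Some s) (Some t)) (Some s) = Some u ->
  raw_mul (raw_mul s t) s = u.
Proof. by rewrite /=; case: ifP => //= _; case: ifP => // _ []. Qed.

Lemma raw_mulgE x y : raw (x * y)%g = oraw_mul (raw x) (raw y).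
Proof. exact: raw_Mbar_mul. Qed.

Lemma Mbar_is_zero : is_zero (None : Mbar R n).
Proof. by move=> x; split=> //; case: x. Qed.

Lemma Mbar_inverse_semigroup : inverse_semigroup (Mbar R n).
Proof.
case=> [a|]; last first.
  by exists None; split=> // y [_ <-]; case: y.
pose b : Mbar R n := Some (Triplet (triplet_cond_inv (valP a))).
exists b; split.
  split; apply: raw_inj; rewrite !raw_mulgE; first exact/oraw_mulKV/valP.
  by have := oraw_mulKV (triplet_cond_inv (valP a)); rewrite raw_invK.
case=> [c|] [/(congr1 (@raw R n)) + /(congr1 (@raw R n))] //.
rewrite !raw_mulgE => /oraw_mul_Some hac /oraw_mul_Some hca.
by apply: raw_inj; rewrite /= (raw_inv_unique hac hca).
Qed.

Definition shift x : group0 (Algebra.to_multiplicative R) :=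
  omap (fun t => t.1.2) (raw x).

Lemma shift_idempotent_pure : idempotent_pure_0morphism (None : Mbar R n) shift.
Proof.
split; first by case.
- move=> x y nz_xy; rewrite /shift raw_mulgE.
  have: raw (x * y)%g <> None by case: (x * y)%g nz_xy.
  rewrite raw_mulgE.
  case: (raw x) (raw y) => [[[k d] m]|] [[[k' d'] m']|] //=.
  by case: ifP.
- case=> // -[[[k d] m] cond_a] [d0]; apply: raw_inj; rewrite raw_mulgE /=.
  have /= le_km := triplet_cond_raw_le cond_a.
  move: d0 => /= ->.
  (* the unit of the multiplicative copy of R is its zero *)
  by rewrite -[1%g]/(0 : R) !subr0 addr0 maxxx minxx le_km.
Qed.

End MbarInverse.

Theorem theorem4 (R : realType) (n : nat) (hn : (2 <= n)%N) :
  strongly_Estar_unitary (Mbar R n).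
Proof.
split; first exact: Mbar_inverse_semigroup.
exists (None : Mbar R n); split; first exact: Mbar_is_zero.
by exists (Algebra.to_multiplicative R), (@shift R n); apply: shift_idempotent_pure.
Qed.
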